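(* Let $\Theta$ be the universal $C^*$-algebra described in the context, with its action $\beta$ of $\mathbb{T}^2$ and fixed-point algebra $\Theta^\beta=\{a\in\Theta : \beta_z(a)=a \text{ for all } z\in\mathbb{T}^2\}$. Let $(C,\mathbb{T}^2,\gamma)$ be a $C^*$-dynamical system and let $\phi:(\Theta,\mathbb{T}^2,\beta)\to(C,\mathbb{T}^2,\gamma)$ be an equivariant $*$-homomorphism, i.e. $\phi\circ\beta_z=\gamma_z\circ\phi$ for all $z\in\mathbb{T}^2$. If the restriction $\phi|_{\Theta^\beta}$ is injective, then $\phi$ is injective.
   Context: Graphs. A directed graph $E$ consists of countable sets $E^0$ (vertices), $E^1$ (edges) and maps $o,t:E^1\to E^0$ (origin, terminus). $E$ is irreducible if for all $a,b\in E^0$ there is a finite directed path from $a$ to $b$. The Cuntz-Krieger relations of a graph $E$ for families $(P_a)_{a\in E^0}$, $(S_e)_{e\in E^1}$ are: the $P_a$ are pairwise orthogonal projections; $S_e^*S_e=P_{t(e)}$; $S_eS_e^*+S_fS_f^*\le P_{o(e)}$ if $e\neq f$ and $o(e)=o(f)$; $P_a=\sum_{o(e)=a}S_eS_e^*$ whenever $0<\#\{e:o(e)=a\}<\infty$. The object $\Omega$. Let $D$ be the directed graph with vertices $u_0,u_1,a_0,a_1$ and edges $\alpha_i,\beta_i,\gamma_i,\delta_i,\epsilon_i$ ($i=0,1$), where $\alpha_i$ goes from $u_i$ to $a_i$, $\beta_i$ and $\gamma_i$ are loops at $a_i$, $\delta_i$ goes from $a_i$ to $u_{1-i}$, and $\epsilon_i$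 goes from $u_i$ to $u_{1-i}$. For $i=0,1$ let $E_i,F_i$ be irreducible directed graphs such that the set $L_i\subseteq E_i^0$ (resp. $M_i\subseteq F_i^0$) of vertices emitting infinitely many edges is nonempty, and fix $v_i\in L_i$, $w_i\in M_i$. $\Omega$ is obtained from $D$, $E_0\times F_0$, $E_1\times F_1$ by identifying $u_i$ with $(v_i,w_i)$. Vertices of $\Omega$: elements of $\bigcup_i(E_i^0\times F_i^0)\cup D^0$ (with $u_i=(v_i,w_i)$). Edges of $\Omega$: elements of $\bigcup_i\bigl((E_i^1\times F_i^0)\cup(E_i^0\times F_i^1)\bigr)\cup D^1$; those in $D^1$ have type $D$, the others type $E_i\times F_i$; $o,t$ are taken coordinatewise. The algebra $\Theta$. $\Theta$ is the universal $C^*$-algebra generated by $P_x$ ($x$ a vertex of $\Omega$) and $S_y$ ($y$ an edge of $\Omega$) with relations: (i) the $P_x$ are pairwise orthogonal projections and the $S_y$ are partial isometries; (ii) for every $a\in E_i^0$, the families $(P_{(a,z)})_{z\in F_i^0}$, $(S_{(a,f)})_{f\in F_i^1}$ satisfy the Cuntz-Krieger relations of $F_i$; (ii') for every $b\in F_i^0$, the families $(P_{(y,b)})_{y\in E_i^0}$, $(S_{(e,b)})_{e\in E_i^1}$ satisfy the Cuntz-Krieger relations of $E_i$; (iii) $S_y^*S_y=P_{t(y)}$ for $y\in D^1$, $S_{\alpha_i}S_{\alpha_i}^*+S_{\epsilon_i}S_{\epsilon_i}^*\le P_{u_i}$, and $P_{a_i}=S_{\beta_i}S_{\beta_i}^*+S_{\gamma_i}S_{\gamma_i}^*+S_{\delta_i}S_{\delta_i}^*$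 for $i=0,1$; (iv) $S_\mu^*S_\nu=0$ if $\mu\in D^1$ and $\nu$ is an edge of type $E_i\times F_i$; (v) for $e\in E_i^1$, $f\in F_i^1$: $S_{(o(e),f)}S_{(e,t(f))}=S_{(e,o(f))}S_{(t(e),f)}$ and $S_{(t(e),f)}S_{(e,t(f))}^*=S_{(e,o(f))}^*S_{(o(e),f)}$. The gauge action $\beta:\mathbb{T}^2\to\mathrm{Aut}(\Theta)$ is given, for $z=(z_1,z_2)$, by $\beta_z(P_x)=P_x$, $\beta_z(S_y)=z_1z_2S_y$ for $y\in D^1$, $\beta_z(S_{(e,b)})=z_1S_{(e,b)}$ for $(e,b)\in E_i^1\times F_i^0$, and $\beta_z(S_{(a,f)})=z_2S_{(a,f)}$ for $(a,f)\in E_i^0\times F_i^1$. *)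

(* Defs.v *)
From HB Require Import structures.
From mathcomp Require Import all_boot all_order all_algebra.
From mathcomp Require Import all_classical all_reals all_analysis.
From mathcomp Require Import complex.

Set Implicit Arguments.
Unset Strict Implicit.
Unset Printing Implicit Defensive.

Import Order.TTheory GRing.Theory Num.Theory numFieldNormedType.Exports.

Local Open Scope classical_set_scope.
Local Open Scope ring_scope.

(* Typing the complex numbers as a numClosedFieldType gives them the topology
   and the normed-module structure that MathComp-Analysis puts on any
   numFieldType; the bare type R[i] does not carry them. *)
Definition Cplx (R : realType) : numClosedFieldType := R[i]%C.

(* C*-algebras need not be unital, hence do not build on a ringType. *)

HB.mixin Record isCStarAlgebra (R : realType) A
    of CompleteNormedModule (Cplx R) A := {
  cmul : A -> A -> A;
  star : A -> A;
  cmulA : associative cmul;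
  cmulDl : left_distributive cmul +%R;
  cmulDr : right_distributive cmul +%R;
  cmulZl : forall (k : Cplx R) (x y : A), cmul (k *: x) y = k *: cmul x y;
  cmulZr : forall (k : Cplx R) (x y : A), cmul x (k *: y) = k *: cmul x y;
  starK : involutive star;
  starD : {morph star : x y / x + y};
  starZ : forall (k : Cplx R) (x : A), star (k *: x) = k^* *: star x;
  starM : forall x y : A, star (cmul x y) = cmul (star y) (star x);
  cnormM : forall x y : A, `|cmul x y| <= `|x| * `|y|;
  cstar_identity : forall x : A, `|cmul (star x) x| = `|x| ^+ 2;
}.

#[short(type="cstarAlgType")]
HB.structure Definition CStarAlgebra (R : realType) :=
  {A of isCStarAlgebra R A & CompleteNormedModule (Cplx R) A}.

Declare Scope cstar_scope.
Delimit Scope cstar_scope with cstar.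
Notation "x ** y" := (cmul x y) (at level 40, left associativity) : cstar_scope.
Notation "x ^†" := (star x) (at level 2, format "x ^†") : cstar_scope.
Local Open Scope cstar_scope.

Section CStarAlgebraTheory.
Variable R : realType.
Implicit Types A B : cstarAlgType R.

Definition projection A (p : A) : Prop := p^† = p /\ p ** p = p.

Definition partial_isometry A (s : A) : Prop := s ** s^† ** s = s.

(* The positive elements are those of the form c^* c. *)
Definition cstar_le A (x y : A) : Prop := exists c : A, y - x = c^† ** c.

Definition star_hom A B (f : A -> B) : Prop :=
  [/\ linear f,
      {morph f : x y / x ** y} &
      {morph f : x / x^†}].

Definition star_automorphism A (f : A -> A) : Prop := star_hom f /\ bijective f.

Definition closed_star_subalgebra A (B : set A) : Prop :=
  [/\ closed B,
      B 0,
      forall (k : Cplx R) x y, B x -> B y -> B (k *: x + y),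
      forall x y, B x -> B y -> B (x ** y) &
      forall x, B x -> B x^†].

Definition generates A (X : set A) : Prop :=
  forall B : set A, closed_star_subalgebra B -> X `<=` B -> B = setT.

(* The 2-torus, a multiplicative group for the componentwise product; an action
   is a function on all of C^2 of which only the values on the torus matter. *)
Definition torus2 : set (Cplx R * Cplx R) :=
  [set z | `|z.1| = 1 /\ `|z.2| = 1].

Definition torus_action A (a : Cplx R * Cplx R -> A -> A) : Prop :=
  [/\ forall z, torus2 z -> star_automorphism (a z),
      a 1 =1 id &
      forall z w, torus2 z -> torus2 w -> a (z * w) =1 a z \o a w].

Definition cstar_dynamical_system A (a : Cplx R * Cplx R -> A -> A) : Prop :=
  torus_action a /\
  forall x : A, {within torus2, continuous (fun z => a z x)}.

Definition fixed_points A (a : Cplx R * Cplx R -> A -> A) : set A :=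
  [set x | forall z, torus2 z -> a z x = x].

Definition equivariant A B (a : Cplx R * Cplx R -> A -> A)
    (b : Cplx R * Cplx R -> B -> B) (f : A -> B) : Prop :=
  forall z, torus2 z -> f \o a z =1 b z \o f.

End CStarAlgebraTheory.

Record digraph := Digraph {
  vertex : countType;
  edge : countType;
  origin : edge -> vertex;
  terminus : edge -> vertex
}.
Arguments origin {d} e.
Arguments terminus {d} e.

Definition out_edges (G : digraph) (a : vertex G) : set (edge G) :=
  [set e | origin e = a].

Fixpoint directed_path (G : digraph) (a : vertex G) (p : seq (edge G))
    (b : vertex G) : Prop :=
  if p is e :: q then origin e = a /\ directed_path (terminus e) q b else a = b.

Definition irreducible_graph (G : digraph) : Prop :=
  forall a b : vertex G, exists p : seq (edge G), directed_path a p b.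

Definition infinite_emitter (G : digraph) (a : vertex G) : Prop :=
  infinite_set (out_edges a).

Record cuntz_krieger (R : realType) (A : cstarAlgType R) (G : digraph)
    (P : vertex G -> A) (S : edge G -> A) : Prop := {
  ck_proj : forall a, projection (P a);
  ck_orth : forall a b, a <> b -> P a ** P b = 0;
  ck_initial : forall e, (S e)^† ** S e = P (terminus e);
  ck_range2 : forall e f, e <> f -> origin e = origin f ->
    cstar_le (S e ** (S e)^† + S f ** (S f)^†) (P (origin e));
  ck_sum : forall a, out_edges a !=set0 -> finite_set (out_edges a) ->
    P a = \sum_(e \in out_edges a) S e ** (S e)^†
}.

(* The index i in {0,1} is encoded as a boolean, so that 1-i is ~~ i. *)

Inductive D_vertex := D_u of bool | D_a of bool.

Inductive D_edge :=
  | alpha of bool | beta of bool | gamma of bool | delta of bool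
  | epsilon of bool.

Definition D_origin (y : D_edge) : D_vertex :=
  match y with
  | alpha i => D_u i
  | beta i => D_a i
  | gamma i => D_a i
  | delta i => D_a i
  | epsilon i => D_u i
  end.

Definition D_terminus (y : D_edge) : D_vertex :=
  match y with
  | alpha i => D_a i
  | beta i => D_a i
  | gamma i => D_a i
  | delta i => D_u (~~ i)
  | epsilon i => D_u (~~ i)
  end.

Section Omega.
Variables E F : bool -> digraph.

(* Since u_i is identified with (v_i, w_i), the vertices of Omega are the
   elements of the two products together with a_0 and a_1. *)
Inductive omega_vertex :=
  | prod_vertex i of vertex (E i) & vertex (F i)
  | a_vertex of bool.

Inductive omega_edge :=
  | E_edge i of edge (E i) & vertex (F i)
  | F_edge i of vertex (E i) & edge (F i)
  | of_D_edge of D_edge.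

Variables (v : forall i, vertex (E i)) (w : forall i, vertex (F i)).

Definition of_D_vertex (x : D_vertex) : omega_vertex :=
  match x with
  | D_u i => prod_vertex (v i) (w i)
  | D_a i => a_vertex i
  end.

Definition omega_origin (y : omega_edge) : omega_vertex :=
  match y with
  | E_edge i e b => prod_vertex (origin e) b
  | F_edge i a f => prod_vertex a (origin f)
  | of_D_edge d => of_D_vertex (D_origin d)
  end.

Definition omega_terminus (y : omega_edge) : omega_vertex :=
  match y with
  | E_edge i e b => prod_vertex (terminus e) b
  | F_edge i a f => prod_vertex a (terminus f)
  | of_D_edge d => of_D_vertex (D_terminus d)
  end.

Definition is_product_edge (y : omega_edge) : Prop :=
  if y is of_D_edge _ then False else True.

Variable R : realType.

Record theta_relations (A : cstarAlgType R)
    (P : omega_vertex -> A) (S : omega_edge -> A) : Prop := {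
  theta_proj : forall x, projection (P x);
  theta_orth : forall x x', x <> x' -> P x ** P x' = 0;
  theta_piso : forall y, partial_isometry (S y);
  theta_F : forall i (a : vertex (E i)),
    @cuntz_krieger R A (F i) (fun z => P (prod_vertex a z))
      (fun f => S (F_edge a f));
  theta_E : forall i (b : vertex (F i)),
    @cuntz_krieger R A (E i) (fun y => P (prod_vertex y b))
      (fun e => S (E_edge e b));
  theta_D_initial : forall d : D_edge,
    (S (of_D_edge d))^† ** S (of_D_edge d) = P (omega_terminus (of_D_edge d));
  theta_D_u : forall i,
    cstar_le (S (of_D_edge (alpha i)) ** (S (of_D_edge (alpha i)))^† +
              S (of_D_edge (epsilon i)) ** (S (of_D_edge (epsilon i)))^†)
             (P (of_D_vertex (D_u i)));
  theta_D_a : forall i,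
    P (of_D_vertex (D_a i)) =
      S (of_D_edge (beta i)) ** (S (of_D_edge (beta i)))^† +
      S (of_D_edge (gamma i)) ** (S (of_D_edge (gamma i)))^† +
      S (of_D_edge (delta i)) ** (S (of_D_edge (delta i)))^†;
  theta_D_prod : forall (d : D_edge) (y : omega_edge), is_product_edge y ->
    (S (of_D_edge d))^† ** S y = 0;
  theta_comm : forall i (e : edge (E i)) (f : edge (F i)),
    S (F_edge (origin e) f) ** S (E_edge e (terminus f)) =
    S (E_edge e (origin f)) ** S (F_edge (terminus e) f);
  theta_star_comm : forall i (e : edge (E i)) (f : edge (F i)),
    S (F_edge (terminus e) f) ** (S (E_edge e (terminus f)))^† =
    (S (E_edge e (origin f)))^† ** S (F_edge (origin e) f)
}.

(* Uniqueness of the homomorphism in the universal property follows from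
   theta_generates. *)
Record is_theta (Theta : cstarAlgType R)
    (P : omega_vertex -> Theta) (S : omega_edge -> Theta) : Prop := {
  theta_satisfies : theta_relations P S;
  theta_generates : generates (range P `|` range S);
  theta_universal : forall (B : cstarAlgType R)
      (P' : omega_vertex -> B) (S' : omega_edge -> B),
    theta_relations P' S' ->
    exists h : Theta -> B,
      [/\ star_hom h, forall x, h (P x) = P' x & forall y, h (S y) = S' y]
}.

Definition gauge_weight (z : Cplx R * Cplx R) (y : omega_edge) : Cplx R :=
  match y with
  | E_edge _ _ _ => z.1
  | F_edge _ _ _ => z.2
  | of_D_edge _ => z.1 * z.2
  end.

(* Strong continuity is not required here: it follows from theta_generates. *)
Definition gauge_action (Theta : cstarAlgType R)
    (P : omega_vertex -> Theta) (S : omega_edge -> Theta)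
    (act : Cplx R * Cplx R -> Theta -> Theta) : Prop :=
  [/\ torus_action act,
      forall z x, torus2 z -> act z (P x) = P x &
      forall z y, torus2 z -> act z (S y) = gauge_weight z y *: S y].

End Omega.

(* Main.v *)
Require Import Defs.
From HB Require Import structures.
From mathcomp Require Import all_boot all_order all_algebra.
From mathcomp Require Import all_classical all_reals all_analysis.
From mathcomp Require Import complex.
From mathcomp Require Import cyclic separable cyclotomic zify ring.

Set Implicit Arguments.
Unset Strict Implicit.
Unset Printing Implicit Defensive.

Import Order.TTheory GRing.Theory Num.Theory numFieldNormedType.Exports.

Local Open Scope classical_set_scope.
Local Open Scope ring_scope.

(** Fourier analysis on the 2-torus. Let J be the kernel of phi. An element x of
J which is homogeneous for the gauge action vanishes: x^† x is fixed by the
action ([bihomogeneous_fixed_sqr]) and killed by phi, hence is 0, and the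
C*-identity gives x = 0. It remains to see that J is 0 as soon as it contains no
nonzero homogeneous element. This uses only that J is a closed subspace stable
under the gauge action, that the gauge action is contractive, and that finite
sums of homogeneous elements are dense, the generators being homogeneous
([theta_homogeneous_dense]).

For one circle the argument is [invariant_subspace_eq0]. The Fourier
coefficients of x in J are limits of averages of z^-k tau_z x over the n-th
roots of unity z, so they are homogeneous elements of J ([fourier_mean_cvg]),
and vanish. Averages of partial Fourier sums, the delayed means of de la Vallee
Poussin, are uniformly bounded ([le_delayed_mean]) and reproduce finite sums of
homogeneous elements of bounded degree, so an element all of whose Fourier
coefficients vanish is 0 ([fourier_means_eq0]). Roots of unity take the place of
Haar measure: averages over them are finite sums, and are exact on a finite sum
of homogeneous elements once n exceeds the degrees involved. The passage from
one circle to the torus treats one coordinate at a time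
([torus_invariant_subspace_eq0]).

That J is closed and that the gauge action is contractive both come from the
contractivity of *-homomorphisms ([star_hom_contractive]). It has an elementary
proof: a self-adjoint h of norm < 1 is the real part of the unitary h + i sqrt
(1 - h^2), and a *-homomorphism preserves the algebraic relations that express
this, so the image of h has norm at most 1. *)

Local Open Scope cstar_scope.

(** * Convergence in normed spaces *)

Section NormedConvergence.
Variables (K : numFieldType) (V W : normedModType K).

Lemma lipschitz_cvg (T : Type) (F : set_system T) (FF : Filter F)
    (f : T -> V) (l : V) (g : T -> W) (l' : W) (c : K) :
  0 <= c -> (forall t, `|l' - g t| <= c * `|l - f t|) ->
  f @ F --> l -> g @ F --> l'.
Proof.
move=> c0 le_gf /cvgrPdist_lt cvf; apply/cvgrPdist_lt => e e0.
have c1 : 0 < c + 1 by rewrite ltr_wpDl.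
have := cvf (e / (c + 1)) (divr_gt0 e0 c1); apply: filterS => t.
rewrite ltr_pdivlMr// => lt_fe; apply: le_lt_trans (le_gf t) _.
by apply: le_lt_trans lt_fe; rewrite mulrC ler_wpM2l// lerDl.
Qed.

Lemma lipschitz_continuous (f : V -> W) (c : K) :
  0 <= c -> (forall x y, `|f x - f y| <= c * `|x - y|) -> continuous f.
Proof.
move=> c0 lipf x.
exact: (@lipschitz_cvg _ _ _ id x f (f x) c c0 (fun y => lipf x y)).
Qed.

End NormedConvergence.

Section GeometricSteps.
Variable R : realType.

(** The complex numbers are not an archimedean ordered field, but both s and e
are real, so this is the convergence of powers in R. *)
Lemma exprn_small (s e : Cplx R) :
  0 <= s -> s < 1 -> 0 < e -> exists n, s ^+ n < e.
Proof.
move=> s0 s1 e0.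
have /complex_realP[r sE] : (s : R[i]%C) \is Num.real by apply: ger0_real.
have /complex_realP[d eE] : (e : R[i]%C) \is Num.real by apply/gtr0_real.
move: s0 s1 e0; rewrite sE eE => s0 s1 e0.
have r0 : 0 <= r by rewrite -lecR.
have r1 : r < 1 by rewrite -ltcR.
have d0 : 0 < d by rewrite -ltcR.
have /(@cvg_expr R) /cvgrPdist_lt/(_ d d0)[N _ /(_ N (leqnn N))/=] : `|r| < 1.
  by rewrite ger0_norm.
rewrite sub0r normrN ger0_norm ?exprn_ge0// => rN; exists N.
by move: rN; rewrite -ltcR rmorphXn.
Qed.

Lemma geometric_steps_cvg (V : completeNormedModType (Cplx R)) (u : nat -> V)
    (s : Cplx R) :
  0 <= s -> s < 1 -> (forall n, `|u n.+1 - u n| <= s ^+ n) -> cvgn u.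
Proof.
move=> s0 s1 stepu; apply: cauchy_cvg; apply: cauchy_exP => e e0.
have t0 : 0 < 1 - s by rewrite subr_gt0.
have [N sN] := exprn_small s0 s1 (mulr_gt0 t0 e0).
(* The tail bound telescopes because (1 - s) s^n = s^n - s^(n+1). *)
have tail m : (1 - s) * `|u N - u (N + m)%N| <= s ^+ N - s ^+ (N + m).
  elim: m => [|m IHm]; first by rewrite addn0 !subrr normr0 mulr0.
  apply: le_trans (ler_wpM2l (ltW t0) (ler_distD (u (N + m)%N) _ _)) _.
  rewrite mulrDr addnS.
  have -> : s ^+ N - s ^+ (N + m).+1 =
            (s ^+ N - s ^+ (N + m)) + (1 - s) * s ^+ (N + m).
    by rewrite mulrBl mul1r -exprS addrA subrK.
  by apply: lerD => //; rewrite distrC ler_wpM2l// ltW.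
exists (u N); exists N => // n /= Nn; rewrite -ball_normE /=.
rewrite -(subnKC Nn) -(ltr_pM2l t0); apply: le_lt_trans (tail _) _.
by apply: le_lt_trans sN; rewrite lerBlDr lerDl exprn_ge0.
Qed.

End GeometricSteps.

(** * Maps with a propositional linearity hypothesis *)

Section LinearMaps.
Variables (K : nzRingType) (V W : lmodType K) (f : V -> W).
Hypothesis lin_f : linear f.

Lemma linear_prop0 : f 0 = 0.
Proof.
have := lin_f 1 0 0; rewrite !scale1r addr0 => f0.
by apply: (addrI (f 0)); rewrite addr0 -f0.
Qed.

Lemma linear_propZ k x : f (k *: x) = k *: f x.
Proof. by rewrite -[k *: x]addr0 lin_f linear_prop0 addr0. Qed.

Lemma linear_propD x y : f (x + y) = f x + f y.
Proof. by rewrite -[x in LHS]scale1r lin_f scale1r. Qed.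

Lemma linear_propB x y : f (x - y) = f x - f y.
Proof. by rewrite -[- y]scaleN1r linear_propD linear_propZ scaleN1r. Qed.

End LinearMaps.

(** * Arithmetic and continuity in C*-algebras *)

Section CStarArithmetic.
Variables (R : realType) (A : cstarAlgType R).
Implicit Types x y z : A.

Lemma cmulNl x y : - x ** y = - (x ** y).
Proof. by rewrite -[- x]scaleN1r cmulZl scaleN1r. Qed.

Lemma cmulNr x y : x ** - y = - (x ** y).
Proof. by rewrite -[- y]scaleN1r cmulZr scaleN1r. Qed.

Lemma cmulBl x y z : (x - y) ** z = x ** z - y ** z.
Proof. by rewrite cmulDl cmulNl. Qed.

Lemma cmulBr x y z : x ** (y - z) = x ** y - x ** z.
Proof. by rewrite cmulDr cmulNr. Qed.

Lemma cmul0l x : 0 ** x = 0.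
Proof. by rewrite -[X in X ** _](subrr 0) cmulBl subrr. Qed.

Lemma cmul0r x : x ** 0 = 0.
Proof. by rewrite -[X in _ ** X](subrr 0) cmulBr subrr. Qed.

Lemma star0 : 0^† = 0 :> A.
Proof. by apply: (addrI 0^†); rewrite -starD !addr0. Qed.

Lemma starB x y : (x - y)^† = x^† - y^†.
Proof. by rewrite starD -[- y]scaleN1r starZ rmorphN1 scaleN1r. Qed.

Lemma cstar_eq0 x : x^† ** x = 0 -> x = 0.
Proof.
move=> x0; apply: normr0_eq0; apply/eqP.
by rewrite -sqrf_eq0 -cstar_identity x0 normr0.
Qed.

Lemma norm_star x : `|x^†| = `|x|.
Proof.
have le_star y : `|y| <= `|y^†|.
  have [->|y0] := eqVneq y 0; first by rewrite normr0 normr_ge0.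
  rewrite -(ler_pM2r (_ : 0 < `|y|)) ?normr_gt0// -expr2 -cstar_identity.
  exact: cnormM.
by apply: le_anti; rewrite le_star -{2}[x]starK le_star.
Qed.

Lemma continuous_cmull x : continuous (cmul x).
Proof.
apply: (@lipschitz_continuous _ _ _ _ `|x|) => // y z.
by rewrite -cmulBr cnormM.
Qed.

Lemma continuous_cmulr x : continuous (cmul^~ x).
Proof.
apply: (@lipschitz_continuous _ _ _ _ `|x|) => // y z.
by rewrite -cmulBl mulrC cnormM.
Qed.

Lemma continuous_star : continuous (@star R A).
Proof.
apply: (@lipschitz_continuous _ _ _ _ 1) => // y z.
by rewrite -starB norm_star mul1r.
Qed.

End CStarArithmetic.

(** * Contractivity of *-homomorphisms *)

(** The element k is 1 - sqrt (1 - a), which lies in the algebra even though the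
unit need not. It is the fixed point of k |-> (a + k^2) / 2, a contraction of
ratio `|a| on the ball of radius `|a|, and the iterates from 0 are self-adjoint
and commute with h. *)
Lemma one_minus_sqrt (R : realType) (A : cstarAlgType R) (h a : A) :
  a^† = a -> a ** h = h ** a -> `|a| < 1 ->
  exists k : A, [/\ k^† = k, k ** h = h ** k & k + k - k ** k = a].
Proof.
move=> a_sa ah a1; pose s := `|a|.
have s0 : 0 <= s by exact: normr_ge0.
have half2 : 0 <= 2^-1 :> Cplx R by rewrite invr_ge0 ler0n.
pose step (k : A) := (2^-1 : Cplx R) *: (a + k ** k).
pose u n := iter n step 0.
have u_sa n : (u n)^† = u n.
  elim: n => [|n IHn]; first exact: star0.
  rewrite /u /= -/(u n) /step starZ starD starM IHn a_sa.
  by rewrite rmorphV ?unitfE// rmorph_nat.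
have u_comm n : u n ** h = h ** u n.
  elim: n => [|n IHn]; first by rewrite cmul0l cmul0r.
  rewrite /u /= -/(u n) /step cmulZl cmulZr cmulDl cmulDr ah.
  by rewrite -cmulA IHn cmulA IHn -cmulA.
have u_le n : `|u n| <= s.
  elim: n => [|n IHn]; first by rewrite normr0.
  rewrite /u /= -/(u n) /step normrZ ger0_norm// ler_pdivrMl// mulr_natl mulr2n.
  apply: le_trans (ler_normD _ _) _; apply: lerD => //.
  apply: le_trans (cnormM _ _) _; rewrite -[leRHS]mulr1.
  by apply: ler_pM => //; apply: le_trans IHn (ltW a1).
have u_step n : `|u n.+1 - u n| <= s ^+ n.
  elim: n => [|n IHn].
    by rewrite expr0 subr0 (le_trans (u_le 1%N))// ltW.
  have -> : u n.+2 - u n.+1 =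
      (2^-1 : Cplx R) *: (u n.+1 ** (u n.+1 - u n) + (u n.+1 - u n) ** u n).
    rewrite cmulBl cmulBr addrA subrK {1}/u [X in _ - X]/u /=.
    rewrite -/(u n) -/(u n.+1).
    by rewrite /step -scalerBr opprD addrACA subrr add0r.
  rewrite normrZ ger0_norm// ler_pdivrMl// mulr_natl mulr2n.
  apply: le_trans (ler_normD _ _) _; rewrite exprS; apply: lerD.
    by apply: le_trans (cnormM _ _) _; apply: ler_pM.
  by rewrite mulrC; apply: le_trans (cnormM _ _) _; apply: ler_pM.
have /cvg_ex[k uk] := geometric_steps_cvg s0 a1 u_step.
have cvgun (f g : A -> A) : continuous f -> continuous g ->
    (forall n, f (u n) = g (u n)) -> f k = g k.
  move=> cf cg fg; apply: (@cvg_unique A _ (f \o u @ \oo)).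
  - exact: norm_hausdorff.
  - exact: continuous_cvg (cf k) uk.
  - rewrite (_ : f \o u = g \o u); last exact/funext.
    exact: continuous_cvg (cg k) uk.
exists k; split.
- by apply: (cvgun (@star R A) id) => // x;
    [exact: continuous_star|exact: cvg_id].
- by apply: (cvgun (cmul^~ h) (cmul h)) => // x;
    [exact: continuous_cmulr|exact: continuous_cmull].
- have ->// : k + k = a + k ** k; last by rewrite addrK.
  have step_cont : step \o u @ \oo --> step k.
    apply: (@lipschitz_cvg _ _ _ _ _ _ u k _ _ (s + `|k|)) uk => [|n].
      by rewrite addr_ge0.
    have -> : step k - (step \o u) n =
        (2^-1 : Cplx R) *: (k ** (k - u n) + (k - u n) ** u n).
      by rewrite cmulBl cmulBr addrA subrK -scalerBr opprD addrACA subrr add0r.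
    rewrite normrZ ger0_norm// ler_pdivrMl//.
    apply: (@le_trans _ _ ((s + `|k|) * `|k - u n|)); last first.
      by rewrite mulr_natl mulr2n lerDl mulr_ge0// addr_ge0.
    apply: le_trans (ler_normD _ _) _; rewrite mulrDl addrC; apply: lerD.
      by apply: le_trans (cnormM _ _) _; rewrite mulrC ler_wpM2r.
    exact: cnormM.
  have stepk : step k = k.
    apply: (@cvg_unique A _ (step \o u @ \oo)) => //.
    by move: uk; rewrite -cvg_shiftS.
  rewrite -{1 2}stepk /step -scalerDl.
  by rewrite (_ : 2^-1 + 2^-1 = 1) ?scale1r// [RHS]splitr mul1r.
Qed.


(** With l = 1 - c the hypothesis reads b^2 + c^2 = 1, so that b + i c and
b - i c are unitaries (in the unitization) with mean b. Letting them act by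
left multiplication avoids the unitization. *)
Lemma norm_le1_of_unitaries (R : realType) (B : cstarAlgType R) (b l : B) :
  b^† = b -> l^† = l -> l ** b = b ** l -> l + l - l ** l = b ** b ->
  `|b| <= 1.
Proof.
move=> b_sa l_sa lb sqb.
have unitary (c : Cplx R) (x : B) : c^* = - c -> c ^+ 2 = -1 ->
    `|b ** x + c *: (x - l ** x)| = `|x|.
  move=> cN c2; apply: (@pexpIrn _ 2) => //; rewrite ?nnegrE//.
  rewrite -!cstar_identity; congr `| _ |; set y := x - l ** x.
  have yE : y^† = x^† - x^† ** l by rewrite starB starM l_sa.
  have cross : y^† ** (b ** x) = (x^† ** b) ** y.
    rewrite yE /y cmulBl cmulBr -!cmulA; congr (_ - _ ** _).
    by rewrite !cmulA lb.
  have yy : y^† ** y = x^† ** x - x^† ** b ** (b ** x).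
    rewrite -[in RHS]cmulA [b ** (b ** x)]cmulA -sqb yE /y.
    rewrite !(cmulBl, cmulBr, cmulDl, cmulDr) -!cmulA.
    by rewrite !opprB opprD addrACA !addrA.
  rewrite starD starZ starM b_sa cN cmulDl !cmulDr cmulZl cmulZr cmulZl cmulZr.
  rewrite cross scalerA mulNr -expr2 c2 opprK scale1r yy scaleNr.
  by rewrite addrA addrK addrC subrK.
have le_bx (x : B) : `|b ** x| <= `|x|.
  rewrite -(ler_pM2l (_ : 0 < 2 :> Cplx R)) ?ltr0n//.
  rewrite -[2 in leLHS]ger0_norm ?ler0n//.
  rewrite -normrZ scaler_nat.
  have -> : (b ** x) *+ 2 = (b ** x + 'i *: (x - l ** x)) +
                            (b ** x + (- 'i) *: (x - l ** x)).
    by rewrite addrACA scaleNr subrr addr0 mulr2n.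
  apply: le_trans (ler_normD _ _) _; rewrite mulr_natl mulr2n.
  have iN : ('i : Cplx R)^* = - 'i by exact: conjCi.
  by rewrite !unitary ?sqrrN ?sqrCi// rmorphN /= iN.
have [->|b0] := eqVneq b 0; first by rewrite normr0 ler01.
have := le_bx b; rewrite -{1}b_sa cstar_identity expr2 ger_pMr//.
by rewrite normr_gt0.
Qed.

(** For x of norm < 1 the element star x ** x is self-adjoint of norm < 1, and
the C*-identity passes the bound from it to x. *)
Lemma star_hom_contractive (R : realType) (A B : cstarAlgType R) (f : A -> B) :
  star_hom f -> forall x, `|f x| <= `|x|.
Proof.
case=> lin_f fM fS.
have sa_le1 h : h^† = h -> `|h| < 1 -> `|f h| <= 1.
  move=> h_sa h1.
  have [||//|k [k_sa kh kE]] := @one_minus_sqrt R A h (h ** h).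
  - by rewrite starM h_sa.
  - by rewrite cmulA.
  - by rewrite -{1}h_sa cstar_identity expr_lt1.
  apply: (@norm_le1_of_unitaries _ _ _ (f k)).
  - by rewrite -fS h_sa.
  - by rewrite -fS k_sa.
  - by rewrite -!fM kh.
  - by rewrite -!fM -(linear_propD lin_f) -(linear_propB lin_f) kE.
have le1 x : `|x| < 1 -> `|f x| <= 1.
  move=> x1; rewrite -(@expr_le1 _ 2)// -cstar_identity -fS -fM sa_le1//.
    by rewrite starM starK.
  by rewrite cstar_identity expr_lt1.
move=> x; apply/ler_addgt0Pr => e e0.
have t0 : 0 < `|x| + e by rewrite ltr_wpDl.
rewrite -[leRHS]mulr1 -ler_pdivrMl//.
rewrite -[X in X * _]ger0_norm ?invr_ge0 ?(ltW t0)//.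
rewrite -normrZ -(linear_propZ lin_f); apply: le1.
by rewrite normrZ gtr0_norm ?invr_gt0// ltr_pdivrMl// mulr1 ltrDl.
Qed.

(** * Roots of unity *)

Section RootsOfUnity.
Variable K : numClosedFieldType.

Lemma prim_root_exists n : (0 < n)%N -> exists z : K, n.-primitive_root z.
Proof.
move=> n0; pose p : {poly K} := 'X^n - 1.
have [r pE] := closed_field_poly_normal p.
rewrite (monicP (monicXnsubC 1 n0)) scale1r in pE.
have rn1 : all n.-unity_root r by apply/allP => z; rewrite -root_prod_XsubC -pE.
have size_r : size r = n.
  by apply/eqP; rewrite -eqSS -(size_prod_XsubC r id) -pE size_XnsubC.
have uniq_r : uniq r.
  by rewrite -separable_prod_XsubC -pE separable_Xn_sub_1// pnatr_eq0 -lt0n.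
have /hasP[z _ prim_z] : has n.-primitive_root r.
  by apply: has_prim_root => //; rewrite size_r.
by exists z.
Qed.

Variables (n : nat) (z : K).
Hypothesis prim_z : n.-primitive_root z.

Lemma norm_prim_root : `|z| = 1.
Proof.
apply/eqP; rewrite -(pexpr_eq1 (prim_order_gt0 prim_z))//.
by rewrite -normrX (prim_expr_order prim_z) normr1.
Qed.

Lemma prim_root_neq0 : z != 0.
Proof. by rewrite -normr_eq0 norm_prim_root oner_eq0. Qed.

Lemma norm_prim_rootX j : `|z ^+ j| = 1.
Proof. by rewrite normrX norm_prim_root expr1n. Qed.

Lemma prim_root_exprz_neq1 (d : int) :
  d != 0 -> (`|d| < n)%N -> z ^ d != 1.
Proof.
move=> d0 dn; have d_gt0 : (0 < `|d|)%N by rewrite absz_gt0.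
have : z ^+ `|d| != 1.
  by rewrite -(prim_order_dvd prim_z) gtnNdvd.
case: d {d0 dn d_gt0} => d //= zd.
by rewrite -[_ ^ _]/((z ^+ d.+1)^-1) invr_eq1.
Qed.

Lemma prim_root_sum (d : int) : (`|d| < n)%N ->
  \sum_(j < n) (z ^+ j) ^ d = (if d == 0 then n%:R else 0) :> K.
Proof.
move=> dn; have [->|d0] := eqVneq d 0.
  under eq_bigr do rewrite expr0z.
  by rewrite sumr_const card_ord.
have zd1 : z ^ d - 1 != 0 by rewrite subr_eq0 prim_root_exprz_neq1.
apply: (mulfI zd1); rewrite mulr0.
under eq_bigr do rewrite exprnP exprz_exp mulrC -exprz_exp -exprnP.
rewrite -subrX1 exprnP exprz_exp mulrC -exprz_exp -exprnP.
by rewrite (prim_expr_order prim_z) exp1rz subrr.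
Qed.

(** Parseval's identity for the Dirichlet sums, over the n-th roots of unity. *)
Lemma prim_root_dirichlet_sqr (L : nat) : (L <= n)%N ->
  \sum_(j < n) `|\sum_(l < L) (z ^+ j) ^+ l| ^+ 2 = (n * L)%:R.
Proof.
move=> Ln.
have sqrE (j : 'I_n) : `|\sum_(l < L) (z ^+ j) ^+ l| ^+ 2 =
    \sum_(l < L) \sum_(l' < L) (z ^+ j) ^ (l%:Z - l'%:Z).
  have zj0 : z ^+ j != 0 by rewrite expf_neq0// prim_root_neq0.
  rewrite normCK rmorph_sum mulr_suml; apply: eq_bigr => l _.
  rewrite mulr_sumr; apply: eq_bigr => l' _.
  rewrite rmorphXn/= expfzDr// -exprnN -exprVn; congr (_ * _ ^+ _).
  by rewrite [RHS]invC_norm norm_prim_rootX expr1n invr1 mul1r.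
under eq_bigr do rewrite sqrE.
rewrite exchange_big /= natrM mulr_natr -[L in RHS]card_ord -sumr_const.
apply: eq_bigr => l _; rewrite exchange_big /= (bigD1 l)//=.
rewrite prim_root_sum ?subrr ?(prim_order_gt0 prim_z)// big1 ?addr0// => l' ll'.
have lL := ltn_ord l; have l'L := ltn_ord l'.
rewrite prim_root_sum; last by lia.
by rewrite ifF//; apply: contra_neqF ll' => /eqP ll'; apply/val_inj => /=; lia.
Qed.

End RootsOfUnity.

(** * Fourier coefficients for a contractive action of the circle *)

Lemma closure_normP (K : numFieldType) (V : normedModType K)
    (S : set V) (x : V) :
  closure S x <-> forall e, 0 < e -> exists2 y, S y & `|x - y| < e.
Proof.
split=> [clx e e0|H B /nbhs_normP[e /= e0 sB]].
  have [y [Sy xy]] := clx _ (nbhsx_ballx x e e0).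
  by exists y => //; move: xy; rewrite -ball_normE.
by have [y Sy xy] := H e e0; exists y; split => //; exact: sB.
Qed.

Inductive sums_of (V : zmodType) (H : set V) : set V :=
  | sums_of_nil : sums_of H 0
  | sums_of_cons x y : H x -> sums_of H y -> sums_of H (x + y).

Lemma sums_of_sub (V : zmodType) (H : set V) : H `<=` sums_of H.
Proof. by move=> x Hx; rewrite -[x]addr0; do 2?constructor. Qed.

Lemma sums_ofS (V : zmodType) (H H' : set V) :
  H `<=` H' -> sums_of H `<=` sums_of H'.
Proof.
by move=> HH' x; elim=> [|{}x y Hx _ IHy]; constructor => //; exact: HH'.
Qed.

Lemma norm1_exprz (K : numFieldType) (z : K) (k : int) :
  `|z| = 1 -> `|z ^ k| = 1.
Proof.
move=> z1; case: k => k; first by rewrite -exprnP normrX z1 expr1n.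
by rewrite -[z ^ _]/((z ^+ k.+1)^-1) normfV normrX z1 expr1n invr1.
Qed.

Section CircleAction.
Variables (K : numClosedFieldType) (V : completeNormedModType K).
Variable tau : K -> V -> V.

Definition homogeneous (k : int) : set V :=
  [set x | forall z, `|z| = 1 -> tau z x = z ^ k *: x].

Hypothesis lin_tau : forall z, `|z| = 1 -> linear (tau z).
Hypothesis le_tau : forall z x, `|z| = 1 -> `|tau z x| <= `|x|.

Lemma closed_homogeneous k : closed (homogeneous k).
Proof.
rewrite (_ : homogeneous k = \bigcap_(z in [set z | `|z| = 1])
    [set x | tau z x - z ^ k *: x = 0]); last first.
  apply/seteqP; split => x Hx z z1; first by rewrite /= Hx// subrr.
  by apply/subr0_eq; exact: Hx.
apply: closed_bigI => z z1.
apply: (@preimage_closed _ _ (fun x => tau z x - z ^ k *: x) [set 0]).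
  move=> x _; apply: (@lipschitz_continuous _ _ _ _ 2) => // x' y.
  rewrite opprD addrACA -!opprD -scalerBr -(linear_propB (lin_tau z1)).
  apply: le_trans (ler_normB _ _) _; rewrite normrZ norm1_exprz// mul1r.
  by rewrite mulr_natl mulr2n lerD2r le_tau.
apply: accessible_closed_set1; apply: hausdorff_accessible.
exact: norm_hausdorff.
Qed.

(** The average of z^-k tau_z over the powers z of zeta: a discretization of
the integral that defines the k-th Fourier coefficient. *)
Definition fourier_mean (n : nat) (zeta : K) (k : int) (x : V) : V :=
  n%:R^-1 *: \sum_(j < n) (zeta ^+ j) ^ (- k) *: tau (zeta ^+ j) x.

(** The kernel is that of de la Vallee Poussin: each degree k with |k| <= M
occurs exactly M times among the degrees l' + M - l, once for each l', so that
for 3 M <= n the mean fixes the homogeneous elements of these degrees. *)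
Definition delayed_mean (M n : nat) (zeta : K) (x : V) : V :=
  M%:R^-1 *: \sum_(l' < M) \sum_(l < 3 * M)
    fourier_mean n zeta (l'%:Z + M%:Z - l%:Z) x.

Section FixedRoot.
Variables (n : nat) (zeta : K).
Hypothesis prim_zeta : n.-primitive_root zeta.

Let n_gt0 : (0 < n)%N. Proof. exact: prim_order_gt0 prim_zeta. Qed.
Let zeta1 j : `|zeta ^+ j| = 1. Proof. exact: norm_prim_rootX prim_zeta j. Qed.
Let zeta0 j : zeta ^+ j != 0.
Proof. by rewrite -normr_eq0 zeta1 oner_eq0. Qed.

Lemma fourier_mean_linear k : linear (fourier_mean n zeta k).
Proof.
move=> c x y; rewrite /fourier_mean scalerA mulrC -scalerA -scalerDr.
congr (_ *: _); rewrite scaler_sumr -big_split/=; apply: eq_bigr => j _.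
by rewrite (lin_tau (zeta1 j)) scalerDr !scalerA mulrC.
Qed.

Lemma delayed_mean_linear M : linear (delayed_mean M n zeta).
Proof.
move=> c x y; rewrite /delayed_mean scalerA mulrC -scalerA -scalerDr.
congr (_ *: _); rewrite scaler_sumr -big_split/=; apply: eq_bigr => l' _.
rewrite scaler_sumr -big_split/=; apply: eq_bigr => l _.
exact: fourier_mean_linear.
Qed.

Lemma le_fourier_mean k x : `|fourier_mean n zeta k x| <= `|x|.
Proof.
rewrite normrZ ger0_norm ?invr_ge0// ler_pdivrMl ?ltr0n//.
apply: le_trans (ler_norm_sum _ _ _) _.
rewrite mulr_natl -[n in leRHS]card_ord -sumr_const; apply: ler_sum => j _.
by rewrite normrZ norm1_exprz// mul1r le_tau.
Qed.

Lemma fourier_mean_homogeneous k i x : homogeneous i x -> (`|i - k| < n)%N ->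
  fourier_mean n zeta k x = if i == k then x else 0.
Proof.
move=> Hx ikn; rewrite /fourier_mean.
under eq_bigr do rewrite Hx// scalerA -expfzDr// addrC.
rewrite -scaler_suml prim_root_sum// subr_eq0.
case: ifP => _; rewrite ?scale0r ?scaler0// scalerA mulVf ?scale1r//.
by rewrite pnatr_eq0 -lt0n.
Qed.

Lemma delayed_mean_homogeneous M i x : homogeneous i x ->
  (0 < M)%N -> (`|i| <= M)%N -> (3 * M <= n)%N -> delayed_mean M n zeta x = x.
Proof.
move=> Hx M0 iM Mn; rewrite /delayed_mean.
rewrite (eq_bigr (fun=> x)) => [|l' _]; last first.
  have l'M := ltn_ord l'.
  have lt3M : (`|(l'%:Z + M%:Z - i)%R| < 3 * M)%N by lia.
  rewrite (bigD1 (Ordinal lt3M))//= big1 ?addr0 => [|l /eqP ll'].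
    by rewrite (fourier_mean_homogeneous Hx) ?ifT//; [apply/eqP; lia|lia].
  have l3M := ltn_ord l.
  rewrite (fourier_mean_homogeneous Hx) ?ifF//; last by lia.
  by apply/negP => /eqP il; apply: ll'; apply/val_inj => /=; lia.
rewrite sumr_const card_ord -[x *+ M]scaler_nat scalerA mulVf ?scale1r//.
by rewrite pnatr_eq0 -lt0n.
Qed.

(** The j-th coefficient of the mean is, up to a unimodular factor, a product of
two Dirichlet sums, of lengths M and 3 M; Parseval's identity bounds the sum of
these products by n (M + 3 M) / 2, whence the constant 2. *)
Lemma le_delayed_mean M x : (0 < M)%N -> (3 * M <= n)%N ->
  `|delayed_mean M n zeta x| <= 2 * `|x|.
Proof.
move=> M0 Mn; pose D L j := \sum_(l < L) (zeta ^+ j) ^+ l : K.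
have meanE : delayed_mean M n zeta x = (M * n)%:R^-1 *: \sum_(j < n)
    ((zeta ^+ j) ^ (- M%:Z) * (D M j)^* * D (3 * M)%N j) *: tau (zeta ^+ j) x.
  rewrite /delayed_mean /fourier_mean natrM invfM -scalerA; congr (_ *: _).
  under eq_bigr do rewrite -scaler_sumr exchange_big/=.
  rewrite -scaler_sumr exchange_big/=; congr (_ *: _); apply: eq_bigr => j _.
  rewrite rmorph_sum -mulrA big_distrlr mulr_sumr scaler_suml.
  apply: eq_bigr => l' _; rewrite -scaler_suml mulr_sumr; congr (_ *: _).
  apply: eq_bigr => l _; rewrite !opprD opprK expfzDr// expfzDr//.
  rewrite rmorphXn/= mulrA [_ ^ (- M%:Z) * _]mulrC; congr (_ * _ * _).
  rewrite -exprnN -exprVn; congr (_ ^+ _).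
  by rewrite [LHS]invC_norm zeta1 expr1n invr1 mul1r.
have MnR : 0 < (M * n)%:R :> K by rewrite ltr0n muln_gt0 M0.
rewrite meanE normrZ ger0_norm ?invr_ge0 ?ler0n// ler_pdivrMl//.
apply: (@le_trans _ _ (\sum_(j < n) `|D M j| * `|D (3 * M)%N j| * `|x|)).
  apply: le_trans (ler_norm_sum _ _ _) _; apply: ler_sum => j _.
  rewrite normrZ !normrM norm1_exprz// mul1r norm_conjC.
  by rewrite ler_wpM2l ?mulr_ge0// le_tau.
rewrite -mulr_suml mulrA ler_wpM2r//.
rewrite -(ler_pM2l (_ : 0 < 2 :> K)) ?ltr0n//.
have -> : 2 * ((M * n)%:R * 2) =
    \sum_(j < n) `|D M j| ^+ 2 + \sum_(j < n) `|D (3 * M)%N j| ^+ 2 :> K.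
  rewrite !(prim_root_dirichlet_sqr prim_zeta)//; last by lia.
  by rewrite -!natrM -natrD; congr _%:R; lia.
rewrite -big_split mulr_sumr; apply: ler_sum => j _ /=.
rewrite mulr_natl -subr_ge0 addrAC -sqrrB.
by rewrite real_exprn_even_ge0// rpredB// normr_real.
Qed.

End FixedRoot.

Hypothesis dense_homogeneous :
  forall x, closure (sums_of (\bigcup_k homogeneous k)) x.

Section FixedRoots.
Variable zeta : nat -> K.
Hypothesis prim_zeta : forall n, n.+1.-primitive_root (zeta n).

Lemma fourier_mean_eventually k p : sums_of (\bigcup_k homogeneous k) p ->
  exists2 y, homogeneous k y &
    \forall n \near \oo, fourier_mean n.+1 (zeta n) k p = y.
Proof.
elim=> [|x {}p [i _ Hx] _ [y Hy [N _ Ny]]].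
  exists 0.
    by move=> z z1; rewrite (linear_prop0 (lin_tau z1)) scaler0.
  apply: nearW => n.
  by rewrite (linear_prop0 (fourier_mean_linear (prim_zeta n) k)).
exists ((if i == k then x else 0) + y).
  case: eqP => [ik|_]; last by rewrite add0r.
  by move=> z z1; rewrite (linear_propD (lin_tau z1)) Hx// Hy// ik -scalerDr.
exists (maxn N `|(i - k)%R|%N) => // n /= nN.
rewrite (linear_propD (fourier_mean_linear (prim_zeta n) k)).
rewrite (fourier_mean_homogeneous (prim_zeta n) Hx); last by lia.
by rewrite Ny//=; lia.
Qed.

(** On a finite sum of homogeneous elements the averages are eventually equal to
the component of degree k; density and contractivity make them Cauchy at every
x, and place the limit in the closed set of homogeneous elements. *)
Lemma fourier_mean_cvg k x : exists2 y, homogeneous k y &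
  fourier_mean n.+1 (zeta n) k x @[n --> \oo] --> y.
Proof.
pose Ek n := fourier_mean n.+1 (zeta n) k.
have approx e : 0 < e -> exists2 y, homogeneous k y &
    \forall n \near \oo, `|y - Ek n x| < e.
  move=> e0.
  have [p Hp xp] := (closure_normP _ _).1 (@dense_homogeneous x) e e0.
  have [y Hy Ey] := fourier_mean_eventually k Hp; exists y => //.
  apply: filterS Ey => n <-.
  rewrite -(linear_propB (fourier_mean_linear _ _))//.
  by apply: le_lt_trans (le_fourier_mean _ _ _) _ => //; rewrite distrC.
have /cvg_ex[y Ey] : cvgn (Ek ^~ x).
  apply: cauchy_cvg; apply: cauchy_exP => e e0.
  by have [y _ Ey] := approx e e0; exists y; rewrite -ball_normE.
exists y => //.
have := @closed_homogeneous k; move=> /closure_id ->.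
apply/closure_normP => e e0; have e20 : 0 < e / 2 by rewrite divr_gt0.
have [y' Hy' Ey'] := approx _ e20; exists y' => //.
have /cvgrPdist_lt/(_ _ e20) yE := Ey.
near \oo => n; rewrite (splitr e).
apply: le_lt_trans (ler_distD (Ek n x) _ _) _.
apply: ltrD; first by near: n.
by rewrite distrC; near: n.
Unshelve. all: by end_near. Qed.

(** The delayed means of x tend to 0 with its Fourier coefficients, while those
of a finite sum p of homogeneous elements near x are eventually p itself; the
means being uniformly bounded, x is near 0. *)
Lemma fourier_means_eq0 x :
  (forall k, fourier_mean n.+1 (zeta n) k x @[n --> \oo] --> (0 : V)) -> x = 0.
Proof.
move=> x0.
have mean0 M : delayed_mean M n.+1 (zeta n) x @[n --> \oo] --> (0 : V).
  have sum0 m (f : nat -> nat -> V) : (forall l, f l @ \oo --> (0 : V)) ->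
      \sum_(l < m) f l n @[n --> \oo] --> (0 : V).
    move=> f0; elim: m => [|m IHm].
      by under eq_fun do rewrite big_ord0; exact: cvg_cst.
    under eq_fun do rewrite big_ord_recr/=.
    by have := cvgD IHm (f0 m); rewrite addr0; exact.
  have : \sum_(l' < M) \sum_(l < 3 * M)
      fourier_mean n.+1 (zeta n) (l'%:Z + M%:Z - l%:Z) x
      @[n --> \oo] --> (0 : V).
    apply: (sum0 _ (fun l' n => \sum_(l < 3 * M)
      fourier_mean n.+1 (zeta n) (l'%:Z + M%:Z - l%:Z) x)) => l'.
    by apply: (sum0 _ (fun l n => fourier_mean n.+1 (zeta n)
      (l'%:Z + M%:Z - l%:Z) x)) => l.
  by move/(cvgZl_tmp (k := M%:R^-1)); rewrite scaler0; exact.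
have mean_id p : sums_of (\bigcup_k homogeneous k) p -> exists M0,
    forall M n, (M0 < M)%N -> (3 * M <= n)%N ->
    delayed_mean M n.+1 (zeta n) p = p.
  elim=> [|y {}p [i _ Hy] _ [M0 IHp]].
    by exists 0%N => M n _ _; exact: (linear_prop0 (delayed_mean_linear _ _)).
  exists (maxn M0 `|i|) => M n M0M Mn.
  rewrite (linear_propD (delayed_mean_linear _ _))// IHp//; last by lia.
  by rewrite (delayed_mean_homogeneous (prim_zeta n) Hy)//; lia.
apply/eqP; rewrite -normr_le0; apply/ler_addgt0Pr => e e0; rewrite add0r.
have e40 : 0 < e / 4 by rewrite divr_gt0.
have [p Hp xp] := (closure_normP _ _).1 (@dense_homogeneous x) _ e40.
have [M0 /(_ M0.+1)Tp] := mean_id p Hp.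
have /cvgrPdist_lt/(_ _ e40)[N _ Tx] := mean0 M0.+1.
pose n := maxn N (3 * M0.+1); have := Tx n (leq_maxl _ _).
rewrite /= sub0r normrN; set T := delayed_mean _ _ _ => Txe.
have TB : T (p - x) = p - T x.
  by rewrite /T (linear_propB (delayed_mean_linear _ _))// Tp// leq_maxr.
rewrite (_ : x = (x - p) + T (p - x) + T x); last first.
  by rewrite TB addrA subrK subrK.
apply: le_trans (ler_normD _ _) _.
apply: le_trans (lerD (ler_normD _ _) (lexx _)) _.
have -> : e = e / 4 + 2 * (e / 4) + e / 4 by field.
apply: lerD _ (ltW Txe); apply: lerD (ltW xp) _.
apply: le_trans (le_delayed_mean (prim_zeta n) _ _ _) _ => //.
  by rewrite leqW// leq_maxr.
by rewrite distrC ler_wpM2l// ltW.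
Qed.

End FixedRoots.

(** The Fourier coefficients of an element of J are homogeneous and belong to J,
which is closed and invariant; so they all vanish. *)
Lemma invariant_subspace_eq0 (J : set V) :
  closed J -> J 0 -> (forall (c : K) x y, J x -> J y -> J (c *: x + y)) ->
  (forall z x, `|z| = 1 -> J x -> J (tau z x)) ->
  (forall k x, J x -> homogeneous k x -> x = 0) ->
  forall x, J x -> x = 0.
Proof.
move=> clJ J0 linJ tauJ J_homog0 x Jx.
have [zeta prim_zeta] := choice (fun n => prim_root_exists K (ltn0Sn n)).
apply: (fourier_means_eq0 prim_zeta) => k.
have [y Hy xy] := fourier_mean_cvg prim_zeta k x; rewrite -[0](J_homog0 k y)//.
apply: closed_cvg xy => //; apply: nearW => n.
rewrite /fourier_mean -[_ *: _]addr0; apply: (linJ) => //.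
apply: big_ind => // [u v Ju Jv|j _].
  by rewrite -[u]scale1r; exact: linJ.
rewrite -[_ *: _]addr0; apply: (linJ) => //; apply: (tauJ) => //.
exact: norm_prim_rootX (prim_zeta n) j.
Qed.

End CircleAction.

Lemma continuous_closure (T U : topologicalType) (f : T -> U) (S : set T)
    (S' : set U) :
  continuous f -> (forall x, S x -> S' (f x)) ->
  forall x, closure S x -> closure S' (f x).
Proof.
move=> cf fS x Sx; rewrite -[closure S' _]/((f @^-1` closure S') x).
have /closure_id -> : closed (f @^-1` closure S').
  by apply: preimage_closed => [y _|]; [exact: cf|exact: closed_closure].
by apply: closureS Sx => y /fS; exact: subset_closure.
Qed.

Lemma continuous_closure2 (T U : topologicalType) (f : T -> T -> U) (S : set T)
    (S' : set U) :
  (forall x, continuous (f x)) -> (forall y, continuous (f^~ y)) ->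
  (forall x y, S x -> S y -> S' (f x y)) ->
  forall x y, closure S x -> closure S y -> closure S' (f x y).
Proof.
move=> cfl cfr fS x y Sx Sy; have /closure_id -> := @closed_closure _ S'.
apply: (continuous_closure (f := f^~ y) (cfr y)) Sx => x' Sx'.
by apply: continuous_closure (cfl x') _ _ Sy => y'; exact: fS.
Qed.

Lemma sums_ofD (V : zmodType) (H : set V) x y :
  sums_of H x -> sums_of H y -> sums_of H (x + y).
Proof.
elim=> [|{}x x' Hx _ IHx'] Hy; first by rewrite add0r.
by rewrite -addrA; constructor => //; exact: IHx'.
Qed.

Lemma sums_of_map (V W : zmodType) (H : set V) (H' : set W) (f : V -> W) :
  f 0 = 0 -> {morph f : x y / x + y} ->
  (forall x, H x -> sums_of H' (f x)) ->
  forall x, sums_of H x -> sums_of H' (f x).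
Proof.
move=> f0 fD fH x; elim=> [|{}x y Hx _ IHy]; first by rewrite f0; constructor.
by rewrite fD; apply: sums_ofD => //; exact: fH.
Qed.

Lemma closed_star_subalgebra_closure_sums (R : realType) (A : cstarAlgType R)
    (H : set A) :
  (forall (c : Cplx R) x, H x -> H (c *: x)) ->
  (forall x y, H x -> H y -> H (x ** y)) -> (forall x, H x -> H x^†) ->
  closed_star_subalgebra (closure (sums_of H)).
Proof.
move=> HZ HM HS; split.
- exact: closed_closure.
- by apply: subset_closure; constructor.
- move=> c; apply: (continuous_closure2 (f := fun x y => c *: x + y)).
  + move=> x; apply: (@lipschitz_continuous _ _ _ _ 1) => // y z.
    by rewrite opprD addrACA subrr add0r mul1r.
  + move=> y; apply: (@lipschitz_continuous _ _ _ _ `|c|) => // x z.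
    by rewrite opprD addrACA subrr addr0 -scalerBr normrZ.
  + move=> x y Hx Hy; apply: sums_ofD => //.
    apply: sums_of_map Hx => [|x1 x2|x1 Hx1]; rewrite ?scaler0 ?scalerDr//.
    by apply: sums_of_sub; exact: HZ.
- apply: (continuous_closure2 (f := @cmul R A)).
  + exact: continuous_cmull.
  + exact: continuous_cmulr.
  + move=> x y Hx Hy.
    apply: (sums_of_map (f := cmul^~ y)) Hx => [|x1 x2|x' Hx'].
    * exact: cmul0l.
    * exact: cmulDl.
    * apply: sums_of_map Hy => [|y1 y2|y' Hy']; [exact: cmul0r|exact: cmulDr|].
      by apply: sums_of_sub; exact: HM.
- apply: continuous_closure; first exact: continuous_star.
  apply: sums_of_map => //; [exact: star0|exact: starD|].
  by move=> x Hx; apply: sums_of_sub; exact: HS.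
Qed.

Section HomogeneousStar.
Variables (R : realType) (A : cstarAlgType R) (tau : Cplx R -> A -> A).
Hypothesis hom_tau : forall z, `|z| = 1 -> star_hom (tau z).

Lemma homogeneousZ (c : Cplx R) k x :
  homogeneous tau k x -> homogeneous tau k (c *: x).
Proof.
move=> Hx z z1; have [lin_tau _ _] := hom_tau z1.
by rewrite (linear_propZ lin_tau) Hx// !scalerA mulrC.
Qed.

Lemma homogeneousM k l x y : homogeneous tau k x -> homogeneous tau l y ->
  homogeneous tau (k + l) (x ** y).
Proof.
move=> Hx Hy z z1; have [_ tauM _] := hom_tau z1.
have z0 : z != 0 by rewrite -normr_eq0 z1 oner_eq0.
by rewrite tauM Hx// Hy// cmulZl cmulZr scalerA expfzDr.
Qed.

Lemma homogeneous_star k x : homogeneous tau k x -> homogeneous tau (- k) x^†.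
Proof.
move=> Hx z z1; have [_ _ tauS] := hom_tau z1.
rewrite tauS Hx// starZ -invr_expz [in RHS]invC_norm norm1_exprz//.
by rewrite expr1n invr1 mul1r.
Qed.

End HomogeneousStar.

(** * Actions of the 2-torus *)

Section TorusAction.
Variables (R : realType) (A : cstarAlgType R).
Variable g : Cplx R * Cplx R -> A -> A.
Hypothesis act_g : torus_action g.

Let g1 z := g (z, 1).
Let g2 z := g (1, z).

Definition bihomogeneous (k l : int) : set A :=
  homogeneous g1 k `&` homogeneous g2 l.

Lemma torus2_fst (z : Cplx R) : `|z| = 1 -> torus2 (z, 1).
Proof. by move=> z1; split; rewrite //= normr1. Qed.

Lemma torus2_snd (z : Cplx R) : `|z| = 1 -> torus2 (1, z).
Proof. by move=> z1; split; rewrite //= normr1. Qed.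

Lemma torus_action_star_hom z : torus2 z -> star_hom (g z).
Proof. by have [auto_g _ _] := act_g; case/auto_g. Qed.

Lemma torus_action_linear z : torus2 z -> linear (g z).
Proof. by case/torus_action_star_hom. Qed.

Lemma torus_action_contractive z x : torus2 z -> `|g z x| <= `|x|.
Proof.
by move=> /torus_action_star_hom hz; exact: star_hom_contractive hz x.
Qed.

Let hom1 z : `|z| = 1 -> star_hom (g1 z).
Proof. by move=> /torus2_fst/torus_action_star_hom. Qed.

Let hom2 z : `|z| = 1 -> star_hom (g2 z).
Proof. by move=> /torus2_snd/torus_action_star_hom. Qed.

Let lin1 z : `|z| = 1 -> linear (g1 z). Proof. by case/hom1. Qed.
Let lin2 z : `|z| = 1 -> linear (g2 z). Proof. by case/hom2. Qed.

Lemma torus_actionE (z w : Cplx R) x :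
  `|z| = 1 -> `|w| = 1 -> g (z, w) x = g1 z (g2 w x).
Proof.
move=> z1 w1; have [_ _ gM] := act_g.
rewrite -[RHS](gM _ _ (torus2_fst z1) (torus2_snd w1)).
by rewrite -[(z, 1) * _]/(z * 1, 1 * w) mulr1 mul1r.
Qed.

Lemma torus_actionC (z w : Cplx R) x :
  `|z| = 1 -> `|w| = 1 -> g1 z (g2 w x) = g2 w (g1 z x).
Proof.
move=> z1 w1; have [_ _ gM] := act_g; rewrite -torus_actionE//.
rewrite -[RHS](gM _ _ (torus2_snd w1) (torus2_fst z1)).
by rewrite -[(1, w) * _]/(1 * z, w * 1) mulr1 mul1r.
Qed.

Lemma closed_star_subalgebra_bihomogeneous : closed_star_subalgebra
  (closure (sums_of [set x | exists k l, bihomogeneous k l x])).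
Proof.
apply: closed_star_subalgebra_closure_sums => [c x|x y|x].
- by move=> [k [l [Hk Hl]]]; exists k, l; split; exact: homogeneousZ.
- move=> [k [l [Hk Hl]]] [k' [l' [Hk' Hl']]]; exists (k + k'), (l + l').
  by split; exact: homogeneousM.
- move=> [k [l [Hk Hl]]]; exists (- k), (- l).
  by split; exact: homogeneous_star.
Qed.

Lemma bihomogeneous_fixed_sqr k l x :
  bihomogeneous k l x -> fixed_points g (x^† ** x).
Proof.
move=> [Hk Hl] [z w] [/= z1 w1]; rewrite torus_actionE//.
have H1 := homogeneousM hom1 (homogeneous_star hom1 Hk) Hk.
have H2 := homogeneousM hom2 (homogeneous_star hom2 Hl) Hl.
by rewrite H2// addNr expr0z scale1r H1// addNr expr0z scale1r.
Qed.

(** One circle at a time: by the circle result for the second circle, applied to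
the elements of J of first degree k, J has no nonzero element homogeneous for
the first circle; then the circle result applies to J and the first circle. *)
Lemma torus_invariant_subspace_eq0 (J : set A) :
  (forall x, closure (sums_of [set x | exists k l, bihomogeneous k l x]) x) ->
  closed J -> J 0 -> (forall (c : Cplx R) x y, J x -> J y -> J (c *: x + y)) ->
  (forall z x, torus2 z -> J x -> J (g z x)) ->
  (forall k l x, J x -> bihomogeneous k l x -> x = 0) ->
  forall x, J x -> x = 0.
Proof.
move=> dense clJ J0 linJ gJ J_bihomog0.
have dense1 : forall x, closure (sums_of (\bigcup_k homogeneous g1 k)) x.
  move=> y; apply: closureS (dense y); apply: sums_ofS => u [k [l [Hk _]]].
  by exists k.
have dense2 : forall x, closure (sums_of (\bigcup_k homogeneous g2 k)) x.
  move=> y; apply: closureS (dense y); apply: sums_ofS => u [k [l [_ Hl]]].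
  by exists l.
have le1 z y : `|z| = 1 -> `|g1 z y| <= `|y|.
  by move=> z1; exact: torus_action_contractive (torus2_fst z1).
have le2 z y : `|z| = 1 -> `|g2 z y| <= `|y|.
  by move=> z1; exact: torus_action_contractive (torus2_snd z1).
apply: (invariant_subspace_eq0 lin1 le1 dense1) => //.
  by move=> z y /torus2_fst; exact: gJ.
move=> k x Jx Hx.
apply: (invariant_subspace_eq0 lin2 le2 dense2
  (J := J `&` homogeneous g1 k)) => //.
- by apply: closedI => //; exact: (closed_homogeneous lin1 le1).
- by split=> // z z1; rewrite (linear_prop0 (lin1 z1)) scaler0.
- move=> c u u' [Ju Hu] [Ju' Hu']; split; first exact: linJ.
  by move=> z z1; rewrite (lin1 z1) Hu// Hu'// scalerDr !scalerA mulrC.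
- move=> z u z1 [Ju Hu]; split; first exact: gJ (torus2_snd z1) Ju.
  by move=> z' z'1; rewrite torus_actionC// Hu// (linear_propZ (lin2 z1)).
- by move=> l u [Ju Hk] Hl; exact: (J_bihomog0 k l).
Qed.

End TorusAction.

(** * The gauge action *)

Lemma theta_homogeneous_dense (R : realType) (E F : bool -> digraph)
    (Theta : cstarAlgType R)
    (P : omega_vertex E F -> Theta) (S : omega_edge E F -> Theta)
    (gauge : Cplx R * Cplx R -> Theta -> Theta) :
  generates (range P `|` range S) -> gauge_action P S gauge ->
  forall x, closure (sums_of [set x | exists k l, bihomogeneous gauge k l x]) x.
Proof.
move=> genPS [act_g gP gS] x; set H := [set x | _].
rewrite (genPS (closure (sums_of H)))//.
  exact: closed_star_subalgebra_bihomogeneous.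
move=> _ [[y _ <-]|[y _ <-]]; apply: subset_closure; apply: sums_of_sub.
  exists 0, 0; split=> z z1; rewrite expr0z scale1r gP//.
    exact: torus2_fst.
  exact: torus2_snd.
have [k [l kl]] : exists k l : int, forall z : Cplx R, `|z| = 1 ->
    gauge_weight (z, 1) y = z ^ k /\ gauge_weight (1, z) y = z ^ l.
  case: y => [i e b|i a f|d] /=.
  - by exists 1, 0 => z _; rewrite expr1z expr0z.
  - by exists 0, 1 => z _; rewrite expr1z expr0z.
  - by exists 1, 1 => z _; rewrite expr1z mulr1 mul1r.
exists k, l; split=> z z1; have [wk wl] := kl z z1.
  by rewrite gS ?wk//; exact: torus2_fst.
by rewrite gS ?wl//; exact: torus2_snd.
Qed.

Theorem theorem3p18 (R : realType) (E F : bool -> digraph)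
    (irrE : forall i, irreducible_graph (E i))
    (irrF : forall i, irreducible_graph (F i))
    (v : forall i, vertex (E i)) (w : forall i, vertex (F i))
    (vL : forall i, infinite_emitter (v i))
    (wM : forall i, infinite_emitter (w i))
    (Theta : cstarAlgType R)
    (P : omega_vertex E F -> Theta) (S : omega_edge E F -> Theta)
    (thetaP : is_theta v w P S)
    (gauge : Cplx R * Cplx R -> Theta -> Theta)
    (gaugeP : gauge_action P S gauge)
    (C : cstarAlgType R) (act : Cplx R * Cplx R -> C -> C)
    (actP : cstar_dynamical_system act)
    (phi : Theta -> C) (phi_hom : star_hom phi)
    (phi_equiv : equivariant gauge act phi) :
  set_inj (fixed_points gauge) phi -> injective phi.
Proof.
move=> inj_fix; have [lin_phi phiM _] := phi_hom.
have [act_g _ _] := gaugeP; have [act_c _] := actP.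
suff ker0 x : phi x = 0 -> x = 0.
  move=> x y xy; apply/subr0_eq/ker0.
  by rewrite (linear_propB lin_phi) xy subrr.
move: x; apply: (torus_invariant_subspace_eq0 act_g (J := [set x | phi x = 0])).
- exact: theta_homogeneous_dense (theta_generates thetaP) gaugeP.
- apply: (@preimage_closed _ _ phi [set 0]).
    move=> x _; apply: (@lipschitz_continuous _ _ _ _ 1) => // x' y.
    by rewrite mul1r -(linear_propB lin_phi) star_hom_contractive.
  apply: accessible_closed_set1; apply: hausdorff_accessible.
  exact: norm_hausdorff.
- exact: linear_prop0.
- by move=> c x y x0 y0; rewrite /= lin_phi x0 y0 scaler0 addr0.
- move=> z x tz x0; rewrite /= -[LHS]/((phi \o gauge z) x) phi_equiv//= x0.
  exact: linear_prop0 (torus_action_linear act_c tz).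
- move=> k l x x0 Hx; apply: cstar_eq0; apply: inj_fix; rewrite ?inE.
  + exact: bihomogeneous_fixed_sqr Hx.
  + by move=> z tz; exact: linear_prop0 (torus_action_linear act_g tz).
  + by rewrite phiM x0 cmul0r (linear_prop0 lin_phi).
Qed.
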